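(* Suppose each $f_i$ is strongly convex with constant $\mu_i>0$, $i=1,\dots,m$; let $\mu=\min_i\mu_i$ and $L_h=(1/\mu)(2+2\cos(\pi/m))$. Let $\{\boldsymbol{\lambda}^{(k)}\}_{k\ge0}$ be generated by the inexact dual algorithm with distortions satisfying $\|\mathbf{r}_i^{(k)}\|\le\varepsilon_i$ for all $i,k$ and with stepsizes satisfying $0<\gamma_k\le1/L_h$ for all $k\ge0$. Then, with $h=-g$, for every $k\ge0$, $$h(\boldsymbol{\lambda}^{(k+1)})\le h(\boldsymbol{\lambda}^{(k)})-\frac{\gamma_k}{2}\|\nabla h(\boldsymbol{\lambda}^{(k)})\|^2+\frac{\gamma_k}{2}\epsilon^2 .$$
   Context: Let $m\ge2$, $n\ge1$ be integers, $\mathcal{Y}\subseteq\mathbb{R}^n$ a nonempty closed convex set, and $f_i:\mathbb{R}^n\to\mathbb{R}$, $i=1,\dots,m$, strictly convex closed functions. For $\mathbf{y}=(\mathbf{y}_1,\dots,\mathbf{y}_m)\in(\mathbb{R}^n)^m=\mathbb{R}^{nm}$ put $f(\mathbf{y})=\sum_{i=1}^m f_i(\mathbf{y}_i)$, let $\bar{\mathcal{Y}}=\mathcal{Y}^m$, and $\mathbf{A}\mathbf{y}=(\mathbf{y}_1-\mathbf{y}_2,\dots,\mathbf{y}_{m-1}-\mathbf{y}_m)\in\mathbb{R}^{n(m-1)}$. The dual function is $g(\boldsymbol{\lambda})=\inf_{\mathbf{y}\in\bar{\mathcal{Y}}}\big[f(\mathbf{y})+\boldsymbol{\lambda}^{T}\mathbf{A}\mathbf{y}\big]$,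 $\boldsymbol{\lambda}\in\mathbb{R}^{n(m-1)}$; when all $f_i$ are strongly convex, $g$ is differentiable. Inexact dual algorithm: start from any $\boldsymbol{\lambda}^{(0)}\in\mathbb{R}^{n(m-1)}$; for $k=0,1,2,\dots$ let $\mathbf{y}^{(k)}=\arg\min_{\mathbf{y}\in\bar{\mathcal{Y}}}\big[f(\mathbf{y})+(\boldsymbol{\lambda}^{(k)})^{T}\mathbf{A}\mathbf{y}\big]$, let $\hat{\mathbf{y}}_i^{(k)}=\mathbf{y}_i^{(k)}+\mathbf{r}_i^{(k)}$ where $\mathbf{r}_i^{(k)}\in\mathbb{R}^n$ are arbitrary distortions, let $\hat{\mathbf{d}}^{(k)}=\mathbf{A}\hat{\mathbf{y}}^{(k)}$, and set $\boldsymbol{\lambda}^{(k+1)}=\boldsymbol{\lambda}^{(k)}+\gamma_k\hat{\mathbf{d}}^{(k)}$. The distortions are bounded by constants: $\|\mathbf{r}_i^{(k)}\|\le\varepsilon_i$ for all $i$ and $k$, and $\epsilon:=\sqrt{\sum_{i=1}^{m-1}(\varepsilon_i+\varepsilon_{i+1})^2}$. Norms are Euclidean. A function $\varphi$ is strongly convex with constant $\sigma>0$ if $\varphi-\frac{\sigma}{2}\|\cdot\|^2$ is convex. *)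

(* Defs.v *)
From HB Require Import structures.
From mathcomp Require Import all_boot all_order all_algebra.
From mathcomp Require Import all_classical all_reals all_analysis.

Set Implicit Arguments.
Unset Strict Implicit.
Unset Printing Implicit Defensive.

Import Order.TTheory GRing.Theory Num.Theory.
Import numFieldNormedType.Exports.

Local Open Scope classical_set_scope.
Local Open Scope ring_scope.

(* A point (y_1, ..., y_m) of (R^n)^m is the matrix 'M[R]_(m, n) whose i-th row
   is y_i, and a multiplier in R^(n(m-1)) is a matrix 'M[R]_(m.-1, n).  The
   library's norm `|_| on matrices is the max norm (same topology), so the
   Euclidean structure is defined separately. *)
Definition dotp (R : realType) (p q : nat) (x y : 'M[R]_(p, q)) : R :=
  \sum_(i < p) \sum_(j < q) x i j * y i j.

Definition norm2 (R : realType) (p q : nat) (x : 'M[R]_(p, q)) : R :=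
  Num.sqrt (dotp x x).

Definition closed_function (R : realType) (n : nat) (f : 'rV[R]_n -> R) : Prop :=
  closed [set p : 'rV[R]_n * R^o | f p.1 <= p.2].

Definition strictly_convex (R : realType) (n : nat) (f : 'rV[R]_n -> R) : Prop :=
  forall (x y : 'rV[R]_n) (t : R), x != y -> 0 < t -> t < 1 ->
    f (t *: x + (1 - t) *: y) < t * f x + (1 - t) * f y.

Definition strongly_convex (R : realType) (n : nat) (sigma : R)
    (f : 'rV[R]_n -> R) : Prop :=
  0 < sigma /\
  convex_function (E := 'rV[R]_n) setT
    (fun x => f x - sigma / 2 * norm2 x ^+ 2).

(* The indices i and i + 1 in 'I_m of the i-th difference, i < m - 1. *)
Definition edge_fst (m : nat) (i : 'I_m.-1) : 'I_m := widen_ord (leq_pred m) i.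

Lemma edge_snd_subproof (m : nat) (i : 'I_m.-1) : (i.+1 < m)%N.
Proof. by rewrite -ltn_predRL. Qed.

Definition edge_snd (m : nat) (i : 'I_m.-1) : 'I_m :=
  Ordinal (edge_snd_subproof i).

Definition diff_op (R : realType) (m n : nat) (y : 'M[R]_(m, n)) :
    'M[R]_(m.-1, n) :=
  \matrix_(i, j) (y (edge_fst i) j - y (edge_snd i) j).

Definition prod_set (R : realType) (m n : nat) (Y : set 'rV[R]_n) :
    set 'M[R]_(m, n) :=
  [set y | forall i, Y (row i y)].

Definition lagrangian (R : realType) (m n : nat) (f : 'I_m -> 'rV[R]_n -> R)
    (lam : 'M[R]_(m.-1, n)) (y : 'M[R]_(m, n)) : R :=
  \sum_(i < m) f i (row i y) + dotp lam (diff_op y).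

(* [inf] is the real-valued infimum, meaningful for nonempty sets bounded
   below.  This is the case here when Y is nonempty and every f i is strongly
   convex. *)
Definition dual_function (R : realType) (m n : nat)
    (f : 'I_m -> 'rV[R]_n -> R) (Y : set 'rV[R]_n)
    (lam : 'M[R]_(m.-1, n)) : R :=
  inf [set lagrangian f lam y | y in prod_set Y].

Definition is_argmin (T : Type) (R : realType) (F : T -> R) (D : set T)
    (x : T) : Prop :=
  D x /\ forall z, D z -> F x <= F z.

Definition inexact_dual_run (R : realType) (m n : nat)
    (f : 'I_m -> 'rV[R]_n -> R) (Y : set 'rV[R]_n) (gamma : nat -> R)
    (lam : nat -> 'M[R]_(m.-1, n)) (y r : nat -> 'M[R]_(m, n)) : Prop :=
  forall k : nat,
    is_argmin (lagrangian f (lam k)) (prod_set Y) (y k) /\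
    lam k.+1 = lam k + gamma k *: diff_op (y k + r k).

Definition gradient (R : realType) (p q : nat) (h : 'M[R]_(p, q) -> R^o)
    (x : 'M[R]_(p, q)) : 'M[R]_(p, q) :=
  \matrix_(i, j) 'D_(delta_mx i j) h x.

(* The proof [1 < m] provides the index starting the minimum. *)
Definition min_value (R : realType) (m : nat) (hm : (1 < m)%N)
    (a : 'I_m -> R) : R :=
  \big[Num.min/a (Ordinal (ltnW hm))]_(i < m) a i.

(* Main.v *)
(** If y minimizes the Lagrangian at l, strong convexity gives the quadratic
    growth L(l, z) >= L(l, y) + mu/2 |z - y|^2.  Combined with
    |A w|^2 <= (2 + 2 cos (pi/m)) |w|^2 and completion of the square, this
    sandwiches the dual function for every increment e:
      g(l) + <e, A y> - Lh/2 |e|^2 <= g(l + e) <= g(l) + <e, A y>.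
    Hence g is differentiable at l with gradient A y, and the descent estimate
    is the lower bound taken at e = gamma (A y + A r).  The bound on |A w|^2
    compares w, column by column, with the alternating eigenvector
    (-1)^k sin ((2k + 1) pi / 2m) of the Laplacian of the path. *)
Require Import Defs.
From HB Require Import structures.
From mathcomp Require Import all_boot all_order all_algebra.
From mathcomp Require Import all_classical all_reals all_analysis.
From mathcomp Require Import ring lra.

Set Implicit Arguments.
Unset Strict Implicit.
Unset Printing Implicit Defensive.

Import Order.TTheory GRing.Theory Num.Theory.
Import numFieldNormedType.Exports.

Local Open Scope classical_set_scope.
Local Open Scope ring_scope.

Section DotProduct.
Variables (R : realType) (p q : nat).
Implicit Types x y z : 'M[R]_(p, q).

Lemma dotpC x y : dotp x y = dotp y x.
Proof. by apply: eq_bigr => i _; apply: eq_bigr => j _; rewrite mulrC. Qed.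

Fact dotp_is_linear x : linear (dotp x : _ -> R^o).
Proof.
move=> a y z; rewrite /dotp scaler_sumr -big_split; apply: eq_bigr => i _ /=.
rewrite scaler_sumr -big_split; apply: eq_bigr => j _ /=.
by rewrite !mxE mulrDr mulrCA.
Qed.

HB.instance Definition _ x :=
  GRing.isLinear.Build R 'M[R]_(p, q) R^o _ (dotp x) (dotp_is_linear x).

Lemma dotpDr x y z : dotp x (y + z) = dotp x y + dotp x z.
Proof. exact: linearD. Qed.

Lemma dotpBr x y z : dotp x (y - z) = dotp x y - dotp x z.
Proof. exact: linearB. Qed.

Lemma dotpZr a x y : dotp x (a *: y) = a * dotp x y.
Proof. exact: linearZ. Qed.

Lemma dotpDl x y z : dotp (y + z) x = dotp y x + dotp z x.
Proof. by rewrite dotpC dotpDr !(dotpC x). Qed.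

Lemma dotpBl x y z : dotp (y - z) x = dotp y x - dotp z x.
Proof. by rewrite dotpC dotpBr !(dotpC x). Qed.

Lemma dotpZl a x y : dotp (a *: y) x = a * dotp y x.
Proof. by rewrite dotpC dotpZr dotpC. Qed.

Lemma dotp_ge0 x : 0 <= dotp x x.
Proof.
by apply: sumr_ge0 => i _; apply: sumr_ge0 => j _; rewrite -expr2 sqr_ge0.
Qed.

Lemma norm2_ge0 x : 0 <= norm2 x.
Proof. exact: sqrtr_ge0. Qed.

Lemma sqr_norm2 x : norm2 x ^+ 2 = dotp x x.
Proof. by rewrite sqr_sqrtr ?dotp_ge0. Qed.

Lemma dotp_self_eq0 x : dotp x x = 0 -> x = 0.
Proof.
move=> xx0; apply/matrixP => i j; rewrite mxE; apply/eqP.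
have ge0 k : 0 <= \sum_l x k l * x k l.
  by apply: sumr_ge0 => l _; rewrite -expr2 sqr_ge0.
have /(_ i isT) row0 := psumr_eq0P (fun k _ => ge0 k) xx0.
have sqge0 (l : 'I_q) : true -> 0 <= x i l * x i l.
  by rewrite -expr2 sqr_ge0.
have /(_ j isT)/eqP := psumr_eq0P sqge0 row0.
by rewrite mulf_eq0 orbb.
Qed.

Lemma norm2B_le x y : norm2 (x - y) <= norm2 x + norm2 y.
Proof.
have nx := norm2_ge0 x; have ny := norm2_ge0 y.
rewrite -ler_sqr ?nnegrE ?addr_ge0 ?norm2_ge0//.
have -> : norm2 (x - y) ^+ 2 = norm2 x ^+ 2 + norm2 y ^+ 2 - 2 * dotp x y.
  by rewrite !sqr_norm2 dotpBr !dotpBl (dotpC y); ring.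
suff : - dotp x y <= norm2 x * norm2 y by lra.
have [x0|x0] := eqVneq (norm2 x) 0.
  have /dotp_self_eq0 -> : dotp x x = 0 by rewrite -sqr_norm2 x0 expr0n.
  rewrite dotpC [dotp _ 0]linear0 oppr0; exact: mulr_ge0 (norm2_ge0 _) _.
have [y0|y0] := eqVneq (norm2 y) 0.
  have /dotp_self_eq0 -> : dotp y y = 0 by rewrite -sqr_norm2 y0 expr0n.
  by rewrite [dotp _ 0]linear0 oppr0; exact: mulr_ge0 _ (norm2_ge0 _).
have xy0 : 0 < norm2 x * norm2 y by rewrite mulr_gt0// lt_neqAle eq_sym ?x0 ?y0.
rewrite -(ler_pM2l xy0).
have := dotp_ge0 (norm2 y *: x + norm2 x *: y).
rewrite dotpDr !dotpDl !dotpZl !dotpZr -!sqr_norm2 (dotpC y).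
by nra.
Qed.

Lemma dotp_rows x y : dotp x y = \sum_i dotp (row i x) (row i y).
Proof.
apply: eq_bigr => i _; rewrite /dotp big_ord1.
by apply: eq_bigr => j _; rewrite !mxE.
Qed.

Lemma dotp_le_max_norm x : dotp x x <= p%:R * q%:R * `|x| ^+ 2.
Proof.
rewrite /dotp -mulrA !mulr_natl.
rewrite -[X in _ *+ X]card_ord -sumr_const; apply: ler_sum => i _.
rewrite -[X in _ *+ X]card_ord -sumr_const; apply: ler_sum => j _.
rewrite -expr2 -[_ ^+ 2]real_normK ?num_real// lerXn2r ?nnegrE//.
rewrite [leRHS]/Num.norm/= mx_normrE.
exact: (le_bigmax _ (fun ij : 'I_p * 'I_q => `|x ij.1 ij.2|) (i, j)).
Qed.

Lemma dotp_continuous x : continuous (dotp x : _ -> R^o).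
Proof.
apply: continuous_big => [|i _]; first exact: add_continuous.
apply: continuous_big => [|j _ y]; first exact: add_continuous.
have cij := @coord_continuous R p q i j y.
exact: cvgMl_tmp cij.
Qed.

Lemma dotp_delta x i j : dotp x (delta_mx i j) = x i j.
Proof.
rewrite /dotp (bigD1 i)//= (bigD1 j)//= !mxE !eqxx mulr1 !big1 ?addr0//.
- by move=> k ki; rewrite big1// => l _; rewrite !mxE (negPf ki) mulr0.
- by move=> l lj; rewrite !mxE (negPf lj) andbF mulr0.
Qed.

End DotProduct.

Section QuadraticRemainder.
Variables (R : realType) (V : normedModType R) (h : V -> R^o) (x : V).
Variables (df : {linear V -> R^o}) (C : R).
Hypothesis df_cont : continuous df.
Hypothesis h_bound : forall e, `|h (e + x) - h x - df e| <= C * `|e| ^+ 2.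

Lemma quadratic_remainder_diff : is_diff x h df.
Proof.
have dxf : h \o shift x = cst (h x) + df +o_ 0 id.
  apply/eqaddoP => _ /posnumP[e]; near=> d => /=.
  rewrite opprD addrA (le_trans (h_bound d))// expr2 mulrA ler_wpM2r//.
  rewrite (@le_trans _ _ ((`|C| + 1) * `|d|))//.
    by rewrite ler_wpM2r// (le_trans (ler_norm _))// lerDl.
  rewrite mulrC -ler_pdivlMr; last by rewrite ltr_wpDl.
  near: d; apply: nbhs0_le.
  by rewrite divr_gt0// ltr_wpDl.
split; last exact: diff_unique.
by apply/diff_locallyP; rewrite (diff_unique df_cont dxf).
Unshelve. all: by end_near.
Qed.

End QuadraticRemainder.

Section PathLaplacian.
Variable R : realType.

(* A positive solution v of the eigenvalue recurrence bounds the Laplacian of a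
   path from above: the extra term, quadratic in the last entry, makes the
   induction step a square. *)
Lemma ground_state_le (m : nat) (K : R) (u v : nat -> R) :
  (forall k, (k < m)%N -> 0 < v k) -> K * v 0 = v 0 + v 1 ->
  (forall k, K * v k.+1 = v k + 2 * v k.+1 + v k.+2) ->
  forall k, (k < m)%N ->
  \sum_(0 <= i < k) (u i - u i.+1) ^+ 2 + (v k + v k.+1) / v k * u k ^+ 2
    <= K * \sum_(0 <= i < k.+1) u i ^+ 2.
Proof.
move=> v_gt0 K0 KS; elim=> [|k IH] km.
  rewrite big_nil big_nat1 add0r -K0 mulfK// gt_eqF//; exact: v_gt0.
have {}IH := IH (ltnW km).
have a0 := v_gt0 _ (ltnW km); have b0 := v_gt0 _ km.
rewrite big_nat_recr//= [in leRHS]big_nat_recr//= mulrDr.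
suff : (u k - u k.+1) ^+ 2 + (v k.+1 + v k.+2) / v k.+1 * u k.+1 ^+ 2
    <= (v k + v k.+1) / v k * u k ^+ 2 + K * u k.+1 ^+ 2 by lra.
have -> : K = (v k + 2 * v k.+1 + v k.+2) / v k.+1.
  by rewrite -KS mulfK// gt_eqF.
rewrite -subr_ge0.
rewrite [leRHS](_ : _ = (v k.+1 * u k + v k * u k.+1) ^+ 2 / (v k * v k.+1)).
  by rewrite divr_ge0 ?sqr_ge0// mulr_ge0// ltW.
by field; rewrite !gt_eqF.
Qed.

Lemma path_laplacian_le (m : nat) (u : nat -> R) : (1 < m)%N ->
  \sum_(0 <= i < m.-1) (u i - u i.+1) ^+ 2
    <= (2 + 2 * cos (pi / m%:R)) * \sum_(0 <= i < m) u i ^+ 2.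
Proof.
case: m => // m m0; rewrite [m.+1.-1]/=; set t : R := pi / m.+1%:R.
have pi0 : 0 < pi :> R by exact: pi_gt0.
have mt : m.+1%:R * t = pi by rewrite mulrC divfK// pnatr_eq0.
have t0 : 0 < t by rewrite divr_gt0// ltr0n.
pose v k : R := sin (k%:R * t + t / 2).
have vS a : sin (a + t) + sin (a - t) = 2 * cos t * sin a :> R.
  by rewrite sinD sinB; ring.
have v_gt0 k : (k < m.+1)%N -> 0 < v k.
  move=> km; apply: sin_gt0_pi; rewrite -mt; apply/andP; split.
    by rewrite ltr_wpDl ?divr_gt0// mulr_ge0// ltW.
  have : (k.+1%:R : R) <= m.+1%:R by rewrite ler_nat.
  rewrite -(ler_pM2r t0) -[k.+1]addn1 natrD mulrDl mul1r; lra.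
have K0 : (2 + 2 * cos t) * v 0 = v 0 + v 1.
  rewrite /v mul0r add0r mul1r mulrDl -vS addrC -addrA addrC.
  rewrite (_ : t / 2 - t = - (t / 2)); last by field.
  by rewrite sinN (addrC (t / 2)); ring.
have KS k : (2 + 2 * cos t) * v k.+1 = v k + 2 * v k.+1 + v k.+2.
  rewrite mulrDl -vS /v.
  have -> : k.+1%:R * t + t / 2 - t = k%:R * t + t / 2.
    by rewrite -[k.+1]addn1 natrD; ring.
  have -> : k.+1%:R * t + t / 2 + t = k.+2%:R * t + t / 2.
    by rewrite -[k.+2]addn1 natrD; ring.
  by ring.
have := ground_state_le u v_gt0 K0 KS (leqnn m.+1).
suff -> : v m + v m.+1 = 0 by rewrite !mul0r addr0.
have -> : v m.+1 = sin (t / 2 + pi) by rewrite /v mt addrC.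
have -> : v m = sin (pi - t / 2).
  by rewrite /v -mt -[m.+1]addn1 natrD; congr sin; field.
by rewrite sinDpi sinB sinpi cospi; ring.
Qed.

End PathLaplacian.

Lemma row_diff_op (R : realType) (m n : nat) (y : 'M[R]_(m, n)) i :
  row i (diff_op y) = row (edge_fst i) y - row (edge_snd i) y.
Proof. by apply/rowP => j; rewrite !mxE. Qed.

Lemma diff_opD (R : realType) (m n : nat) (x y : 'M[R]_(m, n)) :
  diff_op (x + y) = diff_op x + diff_op y.
Proof. by apply/matrixP => i j; rewrite !mxE; ring. Qed.

Lemma diff_opZ (R : realType) (m n : nat) a (x : 'M[R]_(m, n)) :
  diff_op (a *: x) = a *: diff_op x.
Proof. by apply/matrixP => i j; rewrite !mxE mulrBr. Qed.

Lemma diff_op_le (R : realType) (m n : nat) (w : 'M[R]_(m, n)) : (1 < m)%N ->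
  dotp (diff_op w) (diff_op w) <= (2 + 2 * cos (pi / m%:R)) * dotp w w.
Proof.
case: m w => // m w m1.
rewrite /dotp exchange_big [in leRHS]exchange_big mulr_sumr.
apply: ler_sum => j _ /=.
have := path_laplacian_le (fun i => w (inord i) j) m1.
rewrite /= !big_mkord; congr (_ <= _ * _); apply: eq_bigr => i _.
  rewrite !mxE -expr2; congr ((w _ j - w _ j) ^+ 2); apply: val_inj.
    by rewrite /= inordK// leqW.
  by rewrite /= inordK// ltnS; exact: ltn_ord.
by rewrite inord_val expr2.
Qed.

Section DualFunction.
Variables (R : realType) (m n : nat).
Variables (f : 'I_m -> 'rV[R]_n -> R) (Y : set 'rV[R]_n).
Implicit Types (l e : 'M[R]_(m.-1, n)) (y z : 'M[R]_(m, n)).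

Lemma strongly_convex_conv (s t : R) (g : 'rV[R]_n -> R) (x y : 'rV[R]_n) :
  strongly_convex s g -> 0 <= t -> t <= 1 ->
  g (t *: x + (1 - t) *: y)
    <= t * g x + (1 - t) * g y - s / 2 * (t * (1 - t) * dotp (x - y) (x - y)).
Proof.
move=> [s0 gs] t0 t1.
have t01 : Itv.spec (@Itv.num_sem R) (Itv.Real `[0%Z, 1%Z]) t.
  by rewrite /Itv.spec/= /Itv.num_sem/= num_real/= in_itv/= t0 t1.
have /= := gs (Itv.mk t01) x y (mem_set I) (mem_set I).
rewrite convRE /conv/= /unstable.onem !sqr_norm2.
rewrite !(dotpBr, dotpBl) !(dotpDr, dotpDl) !(dotpZl, dotpZr) (dotpC y x).
lra.
Qed.

Lemma lagrangianDl l e y :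
  lagrangian f (l + e) y = lagrangian f l y + dotp e (diff_op y).
Proof. by rewrite /lagrangian dotpDl addrA. Qed.

Variables (mu : R) (mus : 'I_m -> R).
Hypothesis mu_gt0 : 0 < mu.
Hypothesis le_mus : forall i, mu <= mus i.
Hypothesis f_sc : forall i, strongly_convex (mus i) (f i).
Hypothesis Y_convex : convex_set (M := 'rV[R]_n) Y.

Lemma lagrangian_conv l (t : R) y z : 0 <= t -> t <= 1 ->
  lagrangian f l (t *: z + (1 - t) *: y)
    <= t * lagrangian f l z + (1 - t) * lagrangian f l y
       - mu / 2 * (t * (1 - t) * dotp (z - y) (z - y)).
Proof.
move=> t0 t1; rewrite /lagrangian diff_opD !diff_opZ dotpDr !dotpZr.
suff : \sum_i f i (row i (t *: z + (1 - t) *: y)) <=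
    t * (\sum_i f i (row i z)) + (1 - t) * (\sum_i f i (row i y))
       - mu / 2 * (t * (1 - t) * dotp (z - y) (z - y)) by lra.
rewrite dotp_rows !mulr_sumr -big_split -sumrB; apply: ler_sum => i _ /=.
have -> : row i (t *: z + (1 - t) *: y) = t *: row i z + (1 - t) *: row i y.
  by apply/rowP => j; rewrite !mxE.
have -> : row i (z - y) = row i z - row i y by apply/rowP => j; rewrite !mxE.
apply: le_trans (strongly_convex_conv _ _ (f_sc i) t0 t1) _.
rewrite lerD2l lerN2 ler_wpM2r//.
  by rewrite mulr_ge0 ?dotp_ge0// mulr_ge0// subr_ge0.
by rewrite ler_wpM2r// invr_ge0.
Qed.

Lemma prod_set_conv (t : R) y z : 0 <= t -> t <= 1 ->
  prod_set Y z -> prod_set Y y -> prod_set Y (t *: z + (1 - t) *: y).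
Proof.
move=> t0 t1 Yz Yy i.
have t01 : Itv.spec (@Itv.num_sem R) (Itv.Real `[0%Z, 1%Z]) t.
  by rewrite /Itv.spec/= /Itv.num_sem/= num_real/= in_itv/= t0 t1.
have := Y_convex (Itv.mk t01) (mem_set (Yz i)) (mem_set (Yy i)).
by rewrite inE linearD !linearZ.
Qed.

Lemma lagrangian_growth l y z :
  is_argmin (lagrangian f l) (prod_set Y) y -> prod_set Y z ->
  lagrangian f l y + mu / 2 * dotp (z - y) (z - y) <= lagrangian f l z.
Proof.
move=> [Yy ymin] Yz; rewrite leNgt; apply/negP.
set a := mu / 2 * _ => lt_a.
set b := lagrangian f l z - lagrangian f l y.
have b0 : 0 <= b by rewrite subr_ge0 ymin.
have ba : b < a by rewrite /b; lra.
have a0 : 0 < a := le_lt_trans b0 ba.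
pose t := (a - b) / (2 * a).
have ta : t * (2 * a) = a - b by rewrite /t divfK// mulf_neq0// gt_eqF.
have t0 : 0 < t by rewrite divr_gt0 ?subr_gt0// mulr_gt0.
have t1 : t <= 1 by nra.
have := le_trans (ymin _ (prod_set_conv (ltW t0) t1 Yz Yy))
  (lagrangian_conv l y z (ltW t0) t1).
rewrite mulrCA -/a -[leLHS]subr0 -subr_ge0 => /[dup] H.
have : 0 <= t * (b - (1 - t) * a) by apply: le_trans H _; rewrite /b; lra.
rewrite pmulr_rge0//; nra.
Qed.

Lemma dual_functionE l y : is_argmin (lagrangian f l) (prod_set Y) y ->
  dual_function f Y l = lagrangian f l y.
Proof.
move=> [Yy ymin]; apply/eqP; rewrite eq_le; apply/andP; split.
  apply: ge_inf; last by exists y.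
  by exists (lagrangian f l y) => _ [z Yz <-]; exact: ymin.
apply: lb_le_inf; first by exists (lagrangian f l y), y.
by move=> _ [z Yz <-]; exact: ymin.
Qed.

Hypothesis m_gt1 : (1 < m)%N.
Let K : R := 2 + 2 * cos (pi / m%:R).

Lemma path_norm_gt0 : 0 < K.
Proof.
have pi0 : 0 < pi :> R by exact: pi_gt0.
suff : 0 <= cos (pi / m%:R) :> R by rewrite /K; lra.
apply: cos_ge0_pihalf; apply/andP; split.
  by rewrite (@le_trans _ _ 0)// ?oppr_le0 divr_ge0// ltW.
by rewrite ler_pM2l// lef_pV2 ?posrE ?ltr0n ?(ltnW m_gt1)// ler_nat.
Qed.

(* Complete the square in w = z - y, after trading |w|^2 for |A w|^2 / K. *)
Lemma lagrangian_shift_ge l e y z :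
  is_argmin (lagrangian f l) (prod_set Y) y -> prod_set Y z ->
  lagrangian f l y + dotp e (diff_op y) - K / (2 * mu) * dotp e e
    <= lagrangian f (l + e) z.
Proof.
move=> ymin Yz; rewrite lagrangianDl.
have := lagrangian_growth ymin Yz; set w := z - y => growth.
have -> : diff_op z = diff_op y + diff_op w by rewrite -diff_opD addrC subrK.
rewrite dotpDr.
have K0 := path_norm_gt0; have := diff_op_le w m_gt1; rewrite -/K.
set Aw := diff_op w => leK.
have sq : 0 <= mu / (2 * K) * dotp Aw Aw + dotp e Aw + K / (2 * mu) * dotp e e.
  have := dotp_ge0 (mu *: Aw + K *: e).
  rewrite dotpDr !dotpDl !dotpZl !dotpZr (dotpC Aw e) => sq.
  rewrite [leRHS](_ : _ = (mu * (mu * dotp Aw Aw) + K * (mu * dotp e Aw)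
    + (mu * (K * dotp e Aw) + K * (K * dotp e e))) / (2 * K * mu)).
    by rewrite divr_ge0// mulr_ge0 ?(ltW mu_gt0)// mulr_ge0// ltW.
  by field; rewrite !gt_eqF.
have : mu / (2 * K) * dotp Aw Aw <= mu / 2 * dotp w w.
  rewrite (_ : mu / 2 * dotp w w = mu / (2 * K) * (K * dotp w w)).
    by rewrite ler_wpM2l// divr_ge0 ?(ltW mu_gt0)// mulr_ge0// ltW.
  by field; rewrite gt_eqF.
lra.
Qed.

Lemma dual_function_shift l e y : is_argmin (lagrangian f l) (prod_set Y) y ->
  dual_function f Y l + dotp e (diff_op y) - K / (2 * mu) * dotp e e
    <= dual_function f Y (l + e) <= dual_function f Y l + dotp e (diff_op y).
Proof.
move=> ymin; have [Yy _] := ymin.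
have lb : lbound [set lagrangian f (l + e) z | z in prod_set Y]
    (dual_function f Y l + dotp e (diff_op y) - K / (2 * mu) * dotp e e).
  move=> _ [z Yz <-]; rewrite (dual_functionE ymin).
  exact: lagrangian_shift_ge.
apply/andP; split.
  by apply: lb_le_inf lb; exists (lagrangian f (l + e) y), y.
rewrite (dual_functionE ymin) -lagrangianDl.
by apply: ge_inf; [eexists; exact: lb | exists y].
Qed.

Lemma dual_function_diff l y : is_argmin (lagrangian f l) (prod_set Y) y ->
  is_diff l (fun l' => - dual_function f Y l' : R^o) (dotp (- diff_op y)).
Proof.
move=> ymin.
pose C := K / (2 * mu).
have C0 : 0 <= C by rewrite divr_ge0 ?mulr_ge0// ltW// path_norm_gt0.
apply: (@quadratic_remainder_diff _ _ _ _ _ (C * (m.-1%:R * n%:R))).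
  exact: dotp_continuous.
move=> e; have := dual_function_shift e ymin.
rewrite (addrC l) -/C => /andP[lo up].
apply: (@le_trans _ _ (C * dotp e e)); last first.
  by rewrite -mulrA ler_wpM2l// dotp_le_max_norm.
rewrite /= -[- diff_op y]scaleN1r dotpZl (dotpC _ e) ler_norml.
apply/andP; split; lra.
Qed.

Lemma dual_gradient l y : is_argmin (lagrangian f l) (prod_set Y) y ->
  gradient (fun l' => - dual_function f Y l') l = - diff_op y.
Proof.
move=> /dual_function_diff dg; apply/matrixP => i j.
by rewrite mxE deriveE// diff_val dotp_delta.
Qed.

End DualFunction.

Lemma distortion_bound (R : realType) (m n : nat) (r : 'M[R]_(m, n))
    (eps : 'I_m -> R) : (forall i, norm2 (row i r) <= eps i) ->
  dotp (diff_op r) (diff_op r)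
    <= \sum_(i < m.-1) (eps (edge_fst i) + eps (edge_snd i)) ^+ 2.
Proof.
move=> r_le; rewrite dotp_rows; apply: ler_sum => i _.
rewrite -sqr_norm2 row_diff_op lerXn2r ?nnegrE ?norm2_ge0//.
  by rewrite addr_ge0// (le_trans (norm2_ge0 _) (r_le _)).
by apply: le_trans (norm2B_le _ _) _; exact: lerD.
Qed.

Lemma min_value_gt0 (R : realType) (m : nat) (hm : (1 < m)%N) (a : 'I_m -> R) :
  (forall i, 0 < a i) -> 0 < min_value hm a.
Proof. by move=> a0; apply: lt_bigmin. Qed.

Theorem lemma1 (R : realType) (m n : nat) (hm : (1 < m)%N) (hn : (0 < n)%N)
  (Y : set 'rV[R]_n) (f : 'I_m -> 'rV[R]_n -> R)
  (mus eps : 'I_m -> R) (gamma : nat -> R)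
  (lam : nat -> 'M[R]_(m.-1, n)) (y r : nat -> 'M[R]_(m, n)) :
  Y !=set0 -> closed Y -> convex_set (M := 'rV[R]_n) Y ->
  (forall i, strictly_convex (f i)) ->
  (forall i, closed_function (f i)) ->
  (forall i, strongly_convex (mus i) (f i)) ->
  inexact_dual_run f Y gamma lam y r ->
  (forall k i, norm2 (row i (r k)) <= eps i) ->
  let mu := min_value hm mus in
  let Lh := 1 / mu * (2 + 2 * cos (pi / m%:R)) in
  let epsilon :=
    Num.sqrt (\sum_(i < m.-1) (eps (edge_fst i) + eps (edge_snd i)) ^+ 2) in
  let h : 'M[R]_(m.-1, n) -> R^o := fun l => - dual_function f Y l in
  (forall k, 0 < gamma k /\ gamma k <= 1 / Lh) ->
  forall k : nat,
    differentiable h (lam k) /\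
    h (lam k.+1) <= h (lam k) - gamma k / 2 * norm2 (gradient h (lam k)) ^+ 2
                    + gamma k / 2 * epsilon ^+ 2.
Proof.
move=> _ _ Yconv _ _ fsc run r_le mu Lh epsilon h gammaP k.
have mu0 : 0 < mu by apply: min_value_gt0 => i; have [] := fsc i.
have le_mus i : mu <= mus i by exact: bigmin_le.
have [ymin ->] := run k; have [gamma0 gammaL] := gammaP k.
have dh := dual_function_diff mu0 le_mus fsc Yconv hm ymin.
split; first exact: ex_diff.
rewrite /h (dual_gradient mu0 le_mus fsc Yconv hm ymin) sqr_norm2.
set d := diff_op (y k); set e := diff_op (r k).
rewrite diff_opD -/d -/e.
have /andP[] := dual_function_shift mu0 le_mus fsc Yconv hm
  (gamma k *: (d + e)) ymin.
rewrite -/d -[- d]scaleN1r !dotpZl !dotpZr.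
set L := _ / (2 * mu).
have LhE : Lh = 2 * L by rewrite /Lh /L; field; rewrite gt_eqF.
have L0 : 0 < L by rewrite divr_gt0 ?mulr_gt0// path_norm_gt0.
have gL : gamma k * (2 * L) <= 1.
  rewrite -LhE -ler_pdivlMr; first exact: gammaL.
  by rewrite LhE mulr_gt0.
have e_le : dotp e e <= epsilon ^+ 2.
  rewrite sqr_sqrtr; first by apply: distortion_bound => i; exact: r_le.
  by apply: sumr_ge0 => i _; exact: sqr_ge0.
have := dotp_ge0 (d + e).
rewrite !dotpDr !dotpDl (dotpC e d).
set g := gamma k in gamma0 gL *; move: (dotp d d) (dotp d e) (dotp e e) e_le.
move=> dd de ee e_le q0 lo _.
set q := dd + de + (de + ee) in q0 lo *.
have gg : L * (g * (g * q)) <= g / 2 * q.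
  rewrite (_ : L * _ = g * (2 * L) * (g / 2 * q)); last by field.
  by rewrite ler_piMl// mulr_ge0// divr_ge0// ltW.
have ge : g / 2 * ee <= g / 2 * epsilon ^+ 2.
  by rewrite ler_wpM2l// divr_ge0// ltW.
rewrite /q in lo gg *; lra.
Qed.
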